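(* Let $a,c$ be nonzero complex numbers and let $\ell,m,n$ be nonnegative integers. Then $$ {}_4\phi_3\left[\begin{matrix}a,\,q^{1-\ell}/a,\,q^{-n},\,-q^{-m-n}\\ c,\,q^{1-\ell-m-2n}/c,\,-q\end{matrix};q,q\right] =\frac{(a,\,q^{\ell-1}ac;q)_\ell}{(c,\,q^{\ell-1}a^2;q)_\ell}\, \frac{(q^{1+m+n},\,-q^{\ell}c;q)_n}{(q^{\ell+m+n}c,\,-q;q)_n}\sum_{i=0}^{\ell}\sum_{j=0}^{m}T_{i,j}, $$ where $$ T_{i,j}=q^{i-nj+\binom{j+1}{2}}\,\frac{(-1)^j}{c^i}\,\frac{1-q^{1-2\ell+2i}/a^2}{1-q^{1-2\ell}/a^2}\, \frac{(q^{-\ell},\,c/a,\,q^{1-2\ell}/a^2;q)_i}{(q,\,q^{2-2\ell}/(ac),\,q^{2-\ell}/a^2;q)_i} $$ $$ \times\frac{(q^{-m},\,q^{-m-n},\,-q^{-m-n},\,q^{2\ell-i-1}ac,\,q^{i}c/a;q)_j}{(q,\,q^{\ell}c,\,-q^{\ell}c,\,q^{-m-2n},\,q^{j-2m-2n-1};q)_j}\, \frac{(q^{2\ell-i+j}ac,\,q^{1+i+j}c/a;q^2)_{m+n-j}}{(q,\,q^{2\ell+2j}c^2;q^2)_{m+n-j}}. $$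
   Context: $q$ is a nonzero complex number. For complex $x$ and an integer $n\ge 0$, the $q$-shifted factorial is $(x;q)_0=1$, $(x;q)_n=\prod_{k=0}^{n-1}(1-xq^k)$, and $(x_1,\dots,x_r;q)_n=\prod_{s=1}^r (x_s;q)_n$ (likewise with base $q^2$ in place of $q$). The basic hypergeometric series is ${}_4\phi_3\left[\begin{matrix}a_0,a_1,a_2,a_3\\ b_1,b_2,b_3\end{matrix};q,z\right]=\sum_{k\ge0}\frac{(a_0,a_1,a_2,a_3;q)_k}{(q,b_1,b_2,b_3;q)_k}z^k$. Here one upper parameter is $q^{-n}$, so the series terminates and means the sum over $0\le k\le n$. Parameters are assumed to be such that no zero factor appears in a denominator of the displayed expressions. *)

(* Defs.v *)
From HB Require Import structures.
From mathcomp Require Import all_boot all_order all_algebra.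
From mathcomp Require Import complex reals.

Set Implicit Arguments.
Unset Strict Implicit.
Unset Printing Implicit Defensive.
Import GRing.Theory.
Local Open Scope ring_scope.

(* (x; q)_n *)
Definition qpoch (F : fieldType) (x q : F) (n : nat) : F :=
  \prod_(0 <= k < n) (1 - x * q ^+ k).

(* (x_1, ..., x_r; q)_n, with xs = [:: x_1; ...; x_r] *)
Definition qpochs (F : fieldType) (xs : seq F) (q : F) (n : nat) : F :=
  \prod_(x <- xs) qpoch x q n.

(* The series 4phi3[a0, a1, a2, a3; b1, b2, b3; q, z], cut after the term of
   index N.  When one of the upper parameters is q^(-N), this is the
   terminating series. *)
Definition phi43 (F : fieldType) (N : nat) (a0 a1 a2 a3 b1 b2 b3 q z : F) : F :=
  \sum_(0 <= k < N.+1)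
    qpochs [:: a0; a1; a2; a3] q k / qpochs [:: q; b1; b2; b3] q k * z ^+ k.

(* The summand T_{i,j}.  Exponents of q that may be negative are taken in int;
   m + n - j is a natural number subtraction, exact for j <= m. *)
Definition Tterm (F : fieldType) (q a c : F) (l m n i j : nat) : F :=
  q ^ (i%:Z - n%:Z * j%:Z + 'C(j.+1, 2)%:Z) * ((-1) ^+ j / c ^+ i)
  * ((1 - q ^ (1 - 2 * l%:Z + 2 * i%:Z) / a ^+ 2)
     / (1 - q ^ (1 - 2 * l%:Z) / a ^+ 2))
  * (qpochs [:: q ^ (- l%:Z); c / a; q ^ (1 - 2 * l%:Z) / a ^+ 2] q i
     / qpochs [:: q; q ^ (2 - 2 * l%:Z) / (a * c); q ^ (2 - l%:Z) / a ^+ 2] q i)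
  * (qpochs [:: q ^ (- m%:Z); q ^ (- m%:Z - n%:Z); - q ^ (- m%:Z - n%:Z);
                q ^ (2 * l%:Z - i%:Z - 1) * a * c; q ^+ i * c / a] q j
     / qpochs [:: q; q ^+ l * c; - q ^+ l * c; q ^ (- m%:Z - 2 * n%:Z);
                  q ^ (j%:Z - 2 * m%:Z - 2 * n%:Z - 1)] q j)
  * (qpochs [:: q ^ (2 * l%:Z - i%:Z + j%:Z) * a * c; q ^+ (1 + i + j) * c / a]
            (q ^+ 2) (m + n - j)
     / qpochs [:: q; q ^+ (2 * l + 2 * j) * c ^+ 2] (q ^+ 2) (m + n - j)).

(* Main.v *)
Require Import Defs.
From mathcomp Require Import all_boot all_order all_algebra.
From mathcomp Require Import complex reals.
From mathcomp Require Import ring zify.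
Import GRing.Theory.
Local Open Scope ring_scope.

(** The parameter [l] is removed first: for each [k],
      (a, q^(1-l)/a; q)_k / (c; q)_k
    is a combination of the (q^(l-i) a, q^(1-l+i)/a; q)_k / (q^l c; q)_k with
    coefficients independent of [k]; this is a terminating very-well-poised
    6phi5 summation whose free parameter is [x = q^k].  It remains to treat
    l = 0.  Sears' transformation (two q-Saalschuetz summations) turns that
    4phi3 into
      4phi3[c/a, ac/q, q^(-n), -q^(-m-n); c, -c, q^(-m-2n); q, q].
    On the other side, Andrews' q-Watson sum expands the quotients in base q^2
    of the j-th summand as a series in (c/a, ac/q; q)_(j+r); collecting the
    terms with j + r = k leaves a second 6phi5 summation, which yields the same
    4phi3.  Every denominator met on the way is nonzero by the hypotheses, so
    no genericity or continuity argument is needed. *)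

Section DoubleSum.
Set Implicit Arguments.
Unset Strict Implicit.

(** * Shifted factorials *)

Lemma binSS2 j : 'C(j.+1, 2) = ('C(j, 2) + j)%N.
Proof. by rewrite binS bin1. Qed.

Lemma bin2D h i : 'C(h + i, 2) = ('C(h, 2) + 'C(i, 2) + h * i)%N.
Proof.
elim: i => [|i IHi]; first by rewrite addn0 muln0 !addn0.
by rewrite addnS !binSS2 IHi mulnS; lia.
Qed.

Section ShiftedFactorials.
Variables (F : fieldType) (q : F).

Implicit Types x y : F.

Lemma qpochS x y n : qpoch x y n.+1 = qpoch x y n * (1 - x * y ^+ n).
Proof. by rewrite /qpoch big_nat_recr. Qed.

Lemma qpoch0 x y : qpoch x y 0 = 1.
Proof. by rewrite /qpoch big_geq. Qed.

Lemma qpochD x y m n : qpoch x y (m + n) = qpoch x y m * qpoch (x * y ^+ m) y n.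
Proof.
elim: n => [|n IHn]; first by rewrite addn0 qpoch0 mulr1.
by rewrite addnS !qpochS IHn -!mulrA exprD.
Qed.

Lemma qpochSl x y n : qpoch x y n.+1 = (1 - x) * qpoch (x * y) y n.
Proof. by rewrite -add1n qpochD qpochS qpoch0 mul1r mulr1. Qed.

Lemma qpoch_neq0 x y n :
  (forall i, (i < n)%N -> x * y ^+ i != 1) <-> qpoch x y n != 0.
Proof.
elim: n => [|n IHn]; first by rewrite qpoch0 oner_eq0.
rewrite qpochS mulf_eq0 negb_or; split=> [h|/andP[/IHn h hn] i].
  apply/andP; split; first by apply/IHn => i hi; apply: h; exact: ltnW.
  by rewrite subr_eq0 eq_sym h.
rewrite ltnS leq_eqVlt => /orP[/eqP->|/h//].
by move: hn; rewrite subr_eq0 eq_sym.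
Qed.

(** Induction step of a Wilf-Zeilberger proof: [t] and [t'] are the summands at [k] and [k + 1], and
    [al / be] is the ratio of the closed forms. The certificate [G] telescopes, and its last value
    is exactly the extra term of the longer sum. *)
Lemma wz_step (al be : F) (t t' G : nat -> F) k :
    (forall j, (j <= k)%N -> al * t j - be * t' j = G j.+1 - G j) ->
    G 0 = 0 -> G k.+1 = be * t' k.+1 ->
  be * \sum_(0 <= j < k.+2) t' j = al * \sum_(0 <= j < k.+1) t j.
Proof.
move=> ht G0 Gk; rewrite big_nat_recr //= mulrDr -Gk.
apply/eqP; rewrite eq_sym addrC -subr_eq !mulr_sumr -sumrB.
rewrite (@telescope_sumr_eq _ 0 k.+1 G) // ?G0 ?subr0 //.
Qed.

Lemma sum_triangle (f : nat -> nat -> F) n :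
  \sum_(0 <= k < n.+1) \sum_(0 <= j < k.+1) f k j =
  \sum_(0 <= j < n.+1) \sum_(0 <= r < (n - j).+1) f (j + r)%N j.
Proof.
elim: n => [|n IHn]; first by rewrite !big_nat1.
rewrite big_nat_recr //= IHn [RHS]big_nat_recr //= subnn big_nat1 addn0.
rewrite [X in _ + X]big_nat_recr //= addrA -big_split /=; congr (_ + _).
apply: eq_big_nat => j /andP[_ hj].
by rewrite subSn // [RHS]big_nat_recr //= -subSn // subnKC // ltnW.
Qed.

End ShiftedFactorials.

(** * Terminating summations *)

(* In the summation proofs below, the last function passed to [wz_step] is the
   Wilf-Zeilberger certificate, written as a multiple of the summand. *)

Section Summations.
Variables (F : fieldType) (q : F).

(** The balanced 3phi2[A, B, q^(-k); ABd, q^(1-k)/d; q, q], multiplied by (d, ABd; q)_k / (q; q)_k.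
    Only (q; q) factors are then left in denominators, so [A], [B] and [d] may be arbitrary. *)
Lemma q_saalschutz A B d k : q != 0 ->
    (forall i, (0 < i <= k)%N -> q ^+ i != 1) ->
  \sum_(0 <= j < k.+1)
     qpoch A q j * qpoch B q j * qpoch d q (k - j)
       * qpoch (A * B * d * q ^+ j) q (k - j) * d ^+ j
       / (qpoch q q j * qpoch q q (k - j))
  = qpoch (A * d) q k * qpoch (B * d) q k / qpoch q q k.
Proof.
move=> q0; elim: k => [|k IHk] hq.
  by rewrite big_nat1 !qpoch0 !mulr1.
have hqn i : (0 < i <= k.+1)%N -> 1 - q ^+ i != 0.
  by move=> /hq; rewrite subr_eq0 eq_sym.
have hp j : (j <= k.+1)%N -> qpoch q q j != 0.
  move=> hj; apply/qpoch_neq0 => i hi; rewrite -exprS.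
  by apply: hq; rewrite /= (leq_trans hi).
have hk : 1 - q ^+ k.+1 != 0 by apply: hqn; rewrite ltnS leqnn.
(* The multipliers are the numerator and denominator of the quotient of the right-hand sides at
   [k + 1] and [k]. *)
have := @wz_step _ ((1 - A * d * q ^+ k) * (1 - B * d * q ^+ k)) (1 - q ^+ k.+1)
  (fun j => qpoch A q j * qpoch B q j * qpoch d q (k - j)
       * qpoch (A * B * d * q ^+ j) q (k - j) * d ^+ j
       / (qpoch q q j * qpoch q q (k - j)))
  (fun j => qpoch A q j * qpoch B q j * qpoch d q (k.+1 - j)
       * qpoch (A * B * d * q ^+ j) q (k.+1 - j) * d ^+ j
       / (qpoch q q j * qpoch q q (k.+1 - j)))
  (fun j => q ^+ (k.+1 - j) * (1 - q ^+ j) *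
       (qpoch A q j * qpoch B q j * qpoch d q (k.+1 - j)
       * qpoch (A * B * d * q ^+ j / q) q (k.+1 - j) * d ^+ j)
       / (qpoch q q j * qpoch q q (k.+1 - j))) k.
rewrite IHk; last by move=> i /andP[i0 ik]; rewrite hq // i0 ltnW.
move=> H; apply: (mulfI hk); rewrite {}H.
- rewrite !qpochS -exprS; field.
  by rewrite hk hp.
- move=> j hj; have [s hs] : exists s, k = (j + s)%N by exists (k - j)%N; rewrite subnKC.
  have -> : (k - j = s)%N by rewrite hs addKn.
  have -> : (k.+1 - j = s.+1)%N by rewrite hs -addnS addKn.
  have -> : (k.+1 - j.+1 = s)%N by rewrite subSS hs addKn.
  have -> : A * B * d * q ^+ j.+1 / q = A * B * d * q ^+ j.
    by rewrite exprSr mulrA mulfK.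
  rewrite (qpochSl (A * B * d * q ^+ j / q)) divfK // !qpochS hs -!exprS.
  have hs1 : (s <= k)%N by rewrite hs leq_addl.
  have h1 := hqn j.+1 hj; have h2 := hqn s.+1 hs1.
  have h3 := hp j (leqW hj); have h4 := hp s (leqW hs1).
  rewrite !exprS exprD in h1 h2 *.
  by field; rewrite q0 h1 h2 h3 h4.
- by rewrite expr0 subrr mulr0 !mul0r.
- by rewrite subnn !qpoch0 expr0 !mulr1 mul1r [RHS]mulrA.
Qed.

(** The base parameter is w = bef/q and the others are b, e, q^(-k), so that wq/b = ef, wq/e = bf
    and wq/(be) = f. The very-well-poised factor is absorbed: the last two products of the
    denominator skip exactly 1 - wq^(2j). No division by 1 - w remains, so w = 1 is allowed. *)
Lemma very_well_poised_6phi5 b e f k : q != 0 ->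
    (forall i, (0 < i <= k)%N -> q ^+ i != 1) ->
    (forall i, (i.+2 <= k.*2)%N -> b * e * f * q ^+ i != 1) ->
  \sum_(0 <= j < k.+1)
     (-1) ^+ j * q ^+ 'C(j, 2) * f ^+ j * (qpoch b q j * qpoch e q j)
       * (qpoch (e * f * q ^+ j) q (k - j) * qpoch (b * f * q ^+ j) q (k - j))
       / (qpoch q q j * qpoch q q (k - j)
          * (qpoch (b * e * f * q ^+ j / q) q j
             * qpoch (b * e * f * q ^+ j.*2) q (k - j)))
  = qpoch f q k / qpoch q q k.
Proof.
move=> q0; elim: k => [|k IHk] hq hw.
  by rewrite big_nat1 !qpoch0 !mulr1.
have hqn i : (0 < i <= k.+1)%N -> 1 - q ^+ i != 0.
  by move=> /hq; rewrite subr_eq0 eq_sym.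
have hp j : (j <= k.+1)%N -> qpoch q q j != 0.
  move=> hj; apply/qpoch_neq0 => i hi; rewrite -exprS.
  by apply: hq; rewrite /= (leq_trans hi).
have hk : 1 - q ^+ k.+1 != 0 by apply: hqn; rewrite ltnS leqnn.
have := @wz_step _ (1 - f * q ^+ k) (1 - q ^+ k.+1)
  (fun j => (-1) ^+ j * q ^+ 'C(j, 2) * f ^+ j * (qpoch b q j * qpoch e q j)
       * (qpoch (e * f * q ^+ j) q (k - j) * qpoch (b * f * q ^+ j) q (k - j))
       / (qpoch q q j * qpoch q q (k - j)
          * (qpoch (b * e * f * q ^+ j / q) q j
             * qpoch (b * e * f * q ^+ j.*2) q (k - j))))
  (fun j => (-1) ^+ j * q ^+ 'C(j, 2) * f ^+ j * (qpoch b q j * qpoch e q j)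
       * (qpoch (e * f * q ^+ j) q (k.+1 - j) * qpoch (b * f * q ^+ j) q (k.+1 - j))
       / (qpoch q q j * qpoch q q (k.+1 - j)
          * (qpoch (b * e * f * q ^+ j / q) q j
             * qpoch (b * e * f * q ^+ j.*2) q (k.+1 - j))))
  (fun j => q ^+ (k.+1 - j) * (1 - q ^+ j) *
       ((-1) ^+ j * q ^+ 'C(j, 2) * f ^+ j * (qpoch b q j * qpoch e q j)
       * (qpoch (e * f * q ^+ j / q) q (k.+1 - j) * qpoch (b * f * q ^+ j / q) q (k.+1 - j)))
       / (qpoch q q j * qpoch q q (k.+1 - j)
          * qpoch (b * e * f * q ^+ j / q) q k.+1)) k.
rewrite IHk; first last.
- by move=> i hi; rewrite hw // (leq_trans hi) // leq_double.
- by move=> i /andP[i0 ik]; rewrite hq // i0 ltnW.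
move=> H; apply: (mulfI hk); rewrite {}H.
- by rewrite !qpochS -exprS; field; rewrite hk hp.
- move=> j hj; have [s hs] : exists s, k = (j + s)%N by exists (k - j)%N; rewrite subnKC.
  have -> : (k - j = s)%N by rewrite hs addKn.
  have -> : (k.+1 - j = s.+1)%N by rewrite hs -addnS addKn.
  have -> : (k.+1 - j.+1 = s)%N by rewrite subSS hs addKn.
  have E x : x * q ^+ j.+1 / q = x * q ^+ j by rewrite exprSr mulrA mulfK.
  rewrite !E.
  rewrite (qpochSl (e * f * q ^+ j / q)) (qpochSl (b * f * q ^+ j / q)) !divfK //.
  have hs1 : (s <= k)%N by rewrite hs leq_addl.
  have h1 := hqn j.+1 hj; have h2 := hqn s.+1 hs1.
  have h3 := hp j (leqW hj); have h4 := hp s (leqW hs1).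
  have hV : qpoch (b * e * f * q ^+ j.*2) q s.+1 != 0.
    apply/qpoch_neq0 => i hi; rewrite -mulrA -exprD; apply: hw.
    by rewrite -!addnn; lia.
  have := hV; rewrite qpochS mulf_eq0 negb_or => /andP[hV1 hV2].
  have -> : qpoch (b * e * f * q ^+ j) q k.+1 =
    qpoch (b * e * f * q ^+ j) q j * qpoch (b * e * f * q ^+ j.*2) q s.+1.
    by rewrite -addnn exprD mulrA hs -addnS qpochD.
  rewrite !binSS2 (exprD q 'C(j, 2) j).
  (* At j = 0 the certificate has 1 - bef/q, which may vanish, in its denominator; its factor 1 -
     q^0 makes it 0 anyway, hence the separate case. *)
  case: j hs h1 h3 hV hV1 hV2 hj E => [|j] hs h1 h3 hV hV1 hV2 hj E.
    rewrite hs double0 !expr0 subrr !qpochS !qpoch0 !(mulr0, mul0r, subr0, mulr1).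
    rewrite double0 expr0 mulr1 in hV1 hV2.
    rewrite expr1 in h1; rewrite (exprS q s) in h2 *; rewrite !expr1.
    by field; rewrite h1 h2 h4 hV1 hV2.
  have hU : qpoch (b * e * f * q ^+ j) q j.+2 != 0.
    apply/qpoch_neq0 => i hi; rewrite -mulrA -exprD; apply: hw.
    by rewrite -!addnn; lia.
  have Ej : b * e * f * q ^+ j.+1 / q = b * e * f * q ^+ j.
    by rewrite exprSr mulrA mulfK.
  rewrite Ej.
  have -> : qpoch (b * e * f * q ^+ j) q k.+1 =
     qpoch (b * e * f * q ^+ j) q j.+2 * qpoch (b * e * f * q ^+ j.+1.*2) q s.
    have -> : (k.+1 = j.+2 + s)%N by rewrite hs.
    rewrite qpochD; congr (_ * qpoch _ _ _).
    by rewrite -[LHS]mulrA -exprD; congr (_ * _ ^+ _); lia.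
  have Ej' : b * e * f * q ^+ j * q = b * e * f * q ^+ j.+1 by rewrite exprSr mulrA.
  move: hU; rewrite (qpochS _ _ j.+1) !(qpochSl (b * e * f * q ^+ j)) Ej'.
  rewrite !mulf_eq0 !negb_or => /andP[/andP[hU1 hU2] hU3].
  rewrite !qpochS hs.
  have Ew : q ^+ j.+1.*2 = q ^+ j.+1 * q ^+ j.+1 by rewrite -exprD addnn.
  rewrite (exprS q j.+1) (exprS q s) in h1 h2.
  rewrite Ew in hV1 hV2; rewrite Ew (exprS q j.+1) (exprS q s).
  rewrite (exprS q (j.+1 + s)) (exprD q j.+1 s) (exprS (-1) j.+1) (exprS f j.+1).
  rewrite (exprS q j) in h1 h2 h3 h4 hU1 hU2 hU3 hV1 hV2 *.
  rewrite qpochS mulf_eq0 negb_or in h3; case/andP: h3 => h3 h5.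
  by field; rewrite q0 h1 h2 h3 h4 h5 hU1 hU2 hU3 hV1 hV2.
- by rewrite expr0 subrr mulr0 !mul0r.
- by rewrite subnn !qpoch0 expr0 !mulr1 mul1r [RHS]mulrA.
Qed.

(** The sum of 4phi3[A, B, q^(-N), -q^(-N); s, -s, q^(-2N); q, q] with s^2 = ABq, multiplied by (q,
    ABq; q^2)_N. In base q^2 only s^2 occurs, so no square root has to be chosen. *)
Lemma andrews_q_watson A B N : q != 0 ->
    (forall i, (0 < i <= 2 * N)%N -> q ^+ i != 1) ->
  \sum_(0 <= r < N.+1)
     q ^+ 'C(r.+1, 2) * (qpoch A q r * qpoch B q r) * qpoch q q (N + (N - r))
       * qpoch (A * B * q * (q ^+ 2) ^+ r) (q ^+ 2) (N - r)
       / (qpoch q q r * qpoch (q ^+ 2) (q ^+ 2) (N - r))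
  = qpoch (A * q) (q ^+ 2) N * qpoch (B * q) (q ^+ 2) N.
Proof.
move=> q0; elim: N => [|k IHk] hq.
  by rewrite big_nat1 !qpoch0 !mulr1 bin_small // expr0 divr1.
have hqn i : (0 < i <= 2 * k.+1)%N -> 1 - q ^+ i != 0.
  by move=> /hq; rewrite subr_eq0 eq_sym.
have hp j : (j <= k.+1)%N -> qpoch q q j != 0.
  move=> hj; apply/qpoch_neq0 => i hi; rewrite -exprS.
  by apply: hq; rewrite /= (leq_trans hi) // (leq_trans hj) // leq_pmull.
have hp2 j : (j <= k.+1)%N -> qpoch (q ^+ 2) (q ^+ 2) j != 0.
  move=> hj; apply/qpoch_neq0 => i hi; rewrite -exprS -exprM.
  by apply: hq; rewrite muln_gt0 /= leq_pmul2l // (leq_trans hi).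
have := @wz_step _ ((1 - A * q * q ^+ (2 * k)) * (1 - B * q * q ^+ (2 * k))) 1
  (fun r => q ^+ 'C(r.+1, 2) * (qpoch A q r * qpoch B q r) * qpoch q q (k + (k - r))
       * qpoch (A * B * q * (q ^+ 2) ^+ r) (q ^+ 2) (k - r)
       / (qpoch q q r * qpoch (q ^+ 2) (q ^+ 2) (k - r)))
  (fun r => q ^+ 'C(r.+1, 2) * (qpoch A q r * qpoch B q r) * qpoch q q (k.+1 + (k.+1 - r))
       * qpoch (A * B * q * (q ^+ 2) ^+ r) (q ^+ 2) (k.+1 - r)
       / (qpoch q q r * qpoch (q ^+ 2) (q ^+ 2) (k.+1 - r)))
  (fun r => (q ^+ 2) ^+ (k.+1 - r) * (1 - q ^+ r) *
       (q ^+ 'C(r.+1, 2) * (qpoch A q r * qpoch B q r) * qpoch q q (k + (k.+1 - r))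
       * qpoch (A * B * q * (q ^+ 2) ^+ r / q ^+ 2) (q ^+ 2) (k.+1 - r))
       / (qpoch q q r * qpoch (q ^+ 2) (q ^+ 2) (k.+1 - r))) k.
rewrite IHk; last first.
  by move=> i /andP[i0 ik]; rewrite hq // i0 (leq_trans ik) // leq_pmul2l.
rewrite (mul1r (\sum_(_ <= _ < _) _)) => ->.
- by rewrite !qpochS -exprM; ring.
- move=> j hj; have [s hs] : exists s, k = (j + s)%N by exists (k - j)%N; rewrite subnKC.
  have -> : (k - j = s)%N by rewrite hs addKn.
  have -> : (k.+1 - j = s.+1)%N by rewrite hs -addnS addKn.
  have -> : (k.+1 - j.+1 = s)%N by rewrite subSS hs addKn.
  have -> : A * B * q * (q ^+ 2) ^+ j.+1 / q ^+ 2 = A * B * q * (q ^+ 2) ^+ j.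
    by rewrite (exprSr _ j) mulrA mulfK // expf_neq0.
  rewrite (qpochSl (A * B * q * (q ^+ 2) ^+ j / q ^+ 2)) divfK ?expf_neq0 //.
  rewrite addSn !addnS !qpochS.
  have hs1 : (s <= k)%N by rewrite hs leq_addl.
  have h1 := hqn j.+1; have h2 := hqn (2 * s.+1)%N.
  rewrite leq_mul2l /= in h2.
  have {}h2 := h2 hs1.
  have {}h1 : 1 - q ^+ j.+1 != 0 by apply: h1; lia.
  have h3 := hp j (leqW hj); have h4 := hp2 s (leqW hs1).
  have EX : (q ^+ 2) ^+ j = q ^+ j * q ^+ j by rewrite exprAC expr2.
  have EY : (q ^+ 2) ^+ s = q ^+ s * q ^+ s by rewrite exprAC expr2.
  have EK : q ^+ (2 * k) = q ^+ j * q ^+ j * (q ^+ s * q ^+ s).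
    by rewrite exprM exprAC hs exprD expr2; ring.
  have EKs : q ^+ (k + s) = q ^+ j * q ^+ s * q ^+ s by rewrite hs !exprD.
  have h6 : 1 - q ^+ 2 * (q ^+ s * q ^+ s) != 0.
    by move: h2; rewrite mulnS exprD exprM EY.
  rewrite (exprS q j) in h1.
  rewrite (binSS2 j.+1) (exprD q 'C(j.+1, 2)) (exprS (q ^+ 2) s).
  rewrite (exprS q (k + s)) (exprS q j) EKs EK EX EY.
  by field; rewrite q0 h1 h6 h3 h4.
- by rewrite expr0 subrr mulr0 !mul0r.
- by rewrite subnn !qpoch0 !addn0 expr0 !mulr1 !mul1r (qpochS q q k) -exprS; ring.
Qed.

End Summations.

(** * The case l = 0 *)

Section SearsTransformation.
Variables (F : fieldType) (q : F).

Lemma qpoch_unit_root n : (forall i, (0 < i <= n)%N -> q ^+ i != 1) ->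
  forall k, (k <= n)%N -> qpoch q q k != 0.
Proof.
move=> hq k hk; apply/qpoch_neq0 => i hi; rewrite -exprS.
by apply: hq; rewrite /= (leq_trans hi).
Qed.

(** Reversing the j factors of (xq^(1-s-j); q)_j releases x^j times this scalar. Where it cancels it
    stays folded, and [field] then needs only that it is nonzero. *)
Definition rev_factor s j : F := (-1) ^+ j / (q ^+ (s * j) * q ^+ 'C(j, 2)).

Lemma rev_factor_neq0 s j : q != 0 -> rev_factor s j != 0.
Proof.
by move=> q0; rewrite mulf_neq0 ?invr_eq0 ?mulf_neq0 ?expf_neq0 ?oppr_eq0 ?oner_eq0.
Qed.

Lemma qpoch_rev (x : F) s j : q != 0 -> x != 0 ->
  qpoch (x * q / q ^+ (s + j)) q j
  = qpoch (x^-1 * q ^+ s) q j * (x ^+ j * rev_factor s j).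
Proof.
move=> q0 x0; elim: j => [|j IHj].
  by rewrite !qpoch0 /rev_factor muln0 bin_small // !expr0 !mulr1 divr1 ?mulr1.
rewrite qpochSl qpochS addnS.
have -> : x * q / q ^+ (s + j).+1 * q = x * q / q ^+ (s + j).
  by rewrite exprS; field; rewrite q0 expf_neq0.
rewrite IHj /rev_factor exprS (exprS x) (exprS (-1)) (exprD q s j) mulnS binSS2.
rewrite (exprD q s) (exprD q 'C(j, 2)).
by field; rewrite q0 x0 !expf_neq0.
Qed.

(** Expanding (a, q/a; q)_k / (c; q)_k by q-Saalschuetz and exchanging the sums leaves an inner sum
    to which q-Saalschuetz applies again. The free [u] becomes q^(m+n) in the application. *)
Lemma sears_q_over_a (a c u : F) n : q != 0 -> a != 0 -> c != 0 -> u != 0 ->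
    (forall i, (0 < i <= n)%N -> q ^+ i != 1) ->
    (forall i, (0 < i <= n)%N -> q ^+ i != -1) ->
    (forall i, (i < n)%N -> c * q ^+ i != 1) ->
    (forall i, (i < n)%N -> - c * q ^+ i != 1) ->
    (forall i, (i < n)%N -> c * u * q ^+ i != 1) ->
    (forall i, (i < n)%N -> u * q * q ^+ i != 1) ->
  \sum_(0 <= k < n.+1)
     qpoch a q k * qpoch (q / a) q k * qpoch (q ^+ n)^-1 q k * qpoch (- u^-1) q k
      / (qpoch q q k * qpoch c q k * qpoch (q / q ^+ n / (c * u)) q k
         * qpoch (- q) q k) * q ^+ k
  = qpoch (u * q) q n * qpoch (- c) q n / (qpoch (c * u) q n * qpoch (- q) q n)
    * \sum_(0 <= k < n.+1)
     qpoch (c / a) q k * qpoch (a * c / q) q k * qpoch (q ^+ n)^-1 q k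
      * qpoch (- u^-1) q k
      / (qpoch q q k * qpoch c q k * qpoch (- c) q k
         * qpoch ((q ^+ n)^-1 / u) q k) * q ^+ k.
Proof.
move=> q0 a0 c0 u0 hq hmq hc hmc hcu huq.
have Pq := qpoch_unit_root hq.
have Pgen x : (forall i, (i < n)%N -> x * q ^+ i != 1) ->
  forall k, (k <= n)%N -> qpoch x q k != 0.
  by move=> hx k hk; apply/qpoch_neq0 => i hi; apply: hx; apply: leq_trans hk.
have Pmq : forall k, (k <= n)%N -> qpoch (- q) q k != 0.
  by apply: Pgen => i hi; rewrite mulNr -exprS eqr_oppLR hmq.
have {}Pc := Pgen _ hc; have Pmc := Pgen _ hmc.
have {}Pcu := Pgen _ hcu; have {Pgen}Puq := Pgen _ huq.
(* The parameters q^(-n), q^(1-n)/(cu) and q^(-n)/u all have the form xq/q^n. Reversal turns them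
   into quotients of products of lengths n and n - k, as the second summation requires. *)
have rev (x : F) k : x != 0 -> (k <= n)%N -> qpoch x^-1 q n != 0 ->
  qpoch (x * q / q ^+ n) q k
  = qpoch x^-1 q n / qpoch x^-1 q (n - k) * (x ^+ k * rev_factor (n - k) k).
  move=> x0 hk hx.
  have {1 2}-> : (n = (n - k) + k)%N by rewrite subnK.
  rewrite qpoch_rev //; congr (_ * _); rewrite qpochD [RHS]mulrC mulKf //.
  by move: hx; rewrite -{1}(subnK hk) qpochD mulf_eq0 negb_or => /andP[].
(* [f k j] arises when (a, q/a; q)_k / (q; q)_k is replaced by its q-Saalschuetz sum with parameters
   c/a, ac/q, q/c, whose product is c. *)
pose f k j :=
  qpoch (c / a) q j * qpoch (a * c / q) q j * qpoch (q / c) q (k - j)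
  * qpoch (c * q ^+ j) q (k - j) * (q / c) ^+ j / (qpoch q q j * qpoch q q (k - j))
  / qpoch c q k * (qpoch (- u^-1) q k / qpoch (- q) q k)
  * (qpoch q q n / qpoch q q (n - k)) * (qpoch (c * u) q (n - k) / qpoch (c * u) q n)
  * (c * u) ^+ k.
transitivity (\sum_(0 <= k < n.+1) \sum_(0 <= j < k.+1) f k j).
  apply: eq_big_nat => k /andP[_ hk]; rewrite ltnS in hk.
  rewrite /f -!mulr_suml.
  have := @q_saalschutz F q (c / a) (a * c / q) (q / c) k q0.
  have -> : c / a * (q / c) = q / a by field; rewrite a0 c0.
  have -> : a * c / q * (q / c) = a by field; rewrite q0 c0.
  have -> : c / a * (a * c / q) * (q / c) = c by field; rewrite q0 a0 c0.
  move=> ->; last by move=> i /andP[i0 ik]; rewrite hq // i0 (leq_trans ik).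
  have -> : qpoch (q ^+ n)^-1 q k = qpoch (q^-1 * q / q ^+ n) q k.
    by rewrite mulVf // mul1r.
  have -> : q / q ^+ n / (c * u) = (c * u)^-1 * q / q ^+ n.
    by rewrite mulrC mulrA.
  rewrite !rev ?invr_eq0 ?mulf_neq0 ?invrK ?Pq ?Pcu ?leqnn //.
  rewrite !exprVn.
  have := rev_factor_neq0 (n - k) k q0.
  have := Pq _ hk; have := Pq _ (leq_subr k n); have := Pcu _ (leq_subr k n).
  have := Pcu _ (leqnn n); have := Pmq _ hk; have := Pc _ hk.
  move=> h1 h2 h3 h4 h5 h6 h7.
  by field; rewrite h1 h2 h3 h4 h5 h6 h7 ?expf_neq0 ?mulf_neq0.
rewrite sum_triangle mulr_sumr; apply: eq_big_nat => j /andP[_ hj].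
rewrite ltnS in hj.
(* [K] collects what is free of r = k - j. The rest is a q-Saalschuetz sum of length n - j with
   parameters -q^j/u, q/c, cu; their product -q^(j+1) accounts for the factor (-q; q)_k. *)
pose K := qpoch (c / a) q j * qpoch (a * c / q) q j * (q / c) ^+ j
  / (qpoch q q j * qpoch c q j) * (qpoch q q n / qpoch (c * u) q n)
  * qpoch (- u^-1) q j * (c * u) ^+ j / qpoch (- q) q n.
have := @q_saalschutz F q (- u^-1 * q ^+ j) (q / c) (c * u) (n - j) q0.
set S := \sum_(_ <= _ < _) _ => hS.
transitivity (K * S).
  rewrite /S mulr_sumr; apply: eq_big_nat => r /andP[_ hr]; rewrite ltnS in hr.
  have hjr : (j + r <= n)%N by rewrite -leq_subRL.
  rewrite /f /K addKn subnDA.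
  have -> : qpoch (- q) q n = qpoch (- q) q (j + r)
      * qpoch (- u^-1 * q ^+ j * (q / c) * (c * u) * q ^+ r) q (n - j - r).
    rewrite -{1}(subnKC hjr) qpochD subnDA; congr (_ * qpoch _ _ _).
    by rewrite exprD; field; rewrite c0 u0.
  have := Pmq _ hjr; have := Pmq _ (leqnn n).
  rewrite -{1}(subnKC hjr) (qpochD (- q)) mulf_eq0 negb_or => /andP[_].
  have -> : - q * q ^+ (j + r) = - u^-1 * q ^+ j * (q / c) * (c * u) * q ^+ r.
    by rewrite exprD; field; rewrite c0 u0.
  have := Pc _ hjr; rewrite (qpochD c) mulf_eq0 negb_or => /andP[h1 h2].
  rewrite -subnDA (qpochD (- u^-1)) (exprD (c * u)).
  have := Pq _ hj; have := Pq r; have := Pq _ (leq_subr (j + r) n).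
  have := Pcu _ (leqnn n).
  move=> h3 h4 /(_ (leq_trans (leq_addl _ _) hjr)) h5 h6 h7 h8.
  by field; rewrite h1 h2 h3 h4 h5 h6 h7 h8.
rewrite hS; last first.
  by move=> i /andP[i0 ik]; rewrite hq // i0 (leq_trans ik) // leq_subr.
have -> : qpoch (q ^+ n)^-1 q j = qpoch (q^-1 * q / q ^+ n) q j.
  by rewrite mulVf // mul1r.
have -> : qpoch ((q ^+ n)^-1 / u) q j = qpoch ((u * q)^-1 * q / q ^+ n) q j.
  by congr (qpoch _ _ _); field; rewrite q0 u0 expf_neq0.
rewrite !rev ?invr_eq0 ?mulf_neq0 ?invrK ?Pq ?Puq ?leqnn // /K.
have -> : - u^-1 * q ^+ j * (c * u) = - c * q ^+ j by field.
have -> : q / c * (c * u) = u * q by field.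
have := rev_factor_neq0 (n - j) j q0.
have Emc : qpoch (- c) q n = qpoch (- c) q j * qpoch (- c * q ^+ j) q (n - j).
  by rewrite -qpochD subnKC.
have := Pmc _ (leqnn n); rewrite Emc mulf_eq0 negb_or; case/andP => h1 h2.
have := Pq _ hj; have := Pq _ (leq_subr j n).
have := Puq _ (leqnn n); have := Puq _ (leq_subr j n).
have := Pcu _ (leqnn n); have := Pmq _ (leqnn n).
have := Pc _ hj.
move=> h3 h4 h5 h6 h7 h8 h9 h10.
rewrite !exprMn !exprVn !exprMn.
by field; rewrite h1 h3 h4 h5 h6 h7 h8 h9 h10 !expf_neq0.
Qed.

End SearsTransformation.

(** * The sum over j for l = 0 *)

Section InnerSum.
Variables (F : fieldType) (q : F).

Lemma qpoch_sqr (x y : F) n :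
  qpoch (x ^+ 2) (y ^+ 2) n = qpoch x y n * qpoch (- x) y n.
Proof.
elim: n => [|n IHn]; first by rewrite !qpoch0 mulr1.
by rewrite !qpochS IHn exprAC (expr2 (y ^+ n)); ring.
Qed.

Lemma qpoch_double (x y : F) n :
  qpoch x y n.*2 = qpoch x (y ^+ 2) n * qpoch (x * y) (y ^+ 2) n.
Proof.
elim: n => [|n IHn]; first by rewrite !qpoch0 mulr1.
by rewrite doubleS !qpochS IHn -!exprM mul2n (exprS y n.*2); ring.
Qed.

Lemma qpoch_eq0 (x y : F) i n : (i < n)%N -> x * y ^+ i = 1 -> qpoch x y n = 0.
Proof.
move=> hi hx; apply/eqP; apply: contraT => /qpoch_neq0 /(_ i hi).
by rewrite hx eqxx.
Qed.

(** Translates the factors of [andrews_q_watson] back into (q^(-N), -q^(-N); q)_r / (q^(-2N); q)_r.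
    At r = 0 it is the splitting (q; q)_(2N) = (q, q^2; q^2)_N, and each step in r compares single
    factors. *)
Lemma qpoch_base_change N r : q != 0 ->
    (forall i, (0 < i <= N.*2)%N -> q ^+ i != 1) -> (r <= N)%N ->
  q ^+ 'C(r, 2) * qpoch q q (N + (N - r)) * qpoch (q ^+ N.*2)^-1 q r =
  qpoch (q ^+ N)^-1 q r * qpoch (- (q ^+ N)^-1) q r
  * (qpoch (q ^+ 2) (q ^+ 2) (N - r) * qpoch q (q ^+ 2) N).
Proof.
move=> q0 hq; elim: r => [|r IHr] hr.
  rewrite bin_small // subn0 !qpoch0 !mulr1 !mul1r addnn qpoch_double mulrC.
  by rewrite -expr2.
have {IHr} := IHr (ltnW hr).
have [s hs] : exists s, N = (r + s).+1 by exists (N - r.+1)%N; lia.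
have -> : (N - r = s.+1)%N by lia.
have -> : (N - r.+1 = s)%N by lia.
rewrite addnS !qpochS binSS2 -exprS.
have h1 : 1 - q ^+ (N + s).+1 != 0.
  by rewrite subr_eq0 eq_sym hq //; lia.
have E1 : q ^+ (N + s).+1 = q ^+ 2 * q ^+ s * q ^+ s * q ^+ r.
  by rewrite -!exprD; congr (_ ^+ _); lia.
have E2 : q ^+ N.*2 = (q ^+ 2 * q ^+ s * q ^+ s * q ^+ r) * q ^+ r.
  by rewrite -!exprD; congr (_ ^+ _); lia.
have E3 : q ^+ N = q * q ^+ s * q ^+ r.
  by rewrite -!exprS -!exprD; congr (_ ^+ _); lia.
have E4 : (q ^+ 2) ^+ s.+1 = q * q ^+ s * (q * q ^+ s).
  by rewrite -!exprS -expr2 -!exprM mulnC.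
rewrite -exprS E4 exprD E1 in h1 *.
have hr0 : q ^+ r != 0 by rewrite expf_neq0.
have hs0 : q ^+ s != 0 by rewrite expf_neq0.
set P1 := qpoch _ _ _; set P2 := qpoch _ _ _; set P3 := qpoch _ _ _.
set P4 := qpoch _ _ _; set P5 := qpoch _ _ _; set P6 := qpoch _ _ _ => IH.
apply: (mulfI h1).
transitivity (q ^+ 'C(r, 2) * (P1 * (1 - q ^+ 2 * q ^+ s * q ^+ s * q ^+ r)) * P2
   * (q ^+ r * (1 - (q ^+ N.*2)^-1 * q ^+ r))); first by ring.
rewrite IH E2 E3; field.
by rewrite q0 hr0 hs0.
Qed.

(** The q-Watson sum with parameters shifted by q^j completes the j-th shifted factorials to index k
    = j + r. For fixed k, j then survives only in a 6phi5 summand. *)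
Lemma double_sum_inner (a c : F) m n : q != 0 -> a != 0 ->
    (forall i, (0 < i <= (m + n).*2)%N -> q ^+ i != 1) ->
    (forall i, (i < m + n)%N -> c * q ^+ i != 1) ->
    (forall i, (i < m + n)%N -> - c * q ^+ i != 1) ->
  let v := (q ^+ (m + n))^-1 in
  \sum_(0 <= j < m.+1)
     q ^+ 'C(j.+1, 2) / q ^+ (n * j) * (-1) ^+ j
     * (qpoch (q ^+ m)^-1 q j * qpoch v q j * qpoch (- v) q j
        * qpoch (a * c / q) q j * qpoch (c / a) q j
        / (qpoch q q j * qpoch c q j * qpoch (- c) q j * qpoch (v / q ^+ n) q j
           * qpoch (v ^+ 2 * q ^+ j / q) q j))
     * (qpoch (a * c * q ^+ j) (q ^+ 2) (m + n - j)
        * qpoch (q * q ^+ j * c / a) (q ^+ 2) (m + n - j)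
        / (qpoch q (q ^+ 2) (m + n - j)
           * qpoch (c ^+ 2 * q ^+ j.*2) (q ^+ 2) (m + n - j)))
  = \sum_(0 <= k < n.+1)
     qpoch (c / a) q k * qpoch (a * c / q) q k * qpoch (q ^+ n)^-1 q k
      * qpoch (- v) q k
      / (qpoch q q k * qpoch c q k * qpoch (- c) q k
         * qpoch ((q ^+ n)^-1 * v) q k) * q ^+ k.
Proof.
move=> q0 a0 hq hc hmc v.
have hv : v != 0 by rewrite invr_eq0 expf_neq0.
(* The first two lines depend on k only. The bracket is the 6phi5 summand for b = q^(-m), e = v, f =
   q^(-n), divided by (v, v/q^n; q)_k: since bf = v = e, the (v; q) factors of that summand merge
   into (v; q)_k. *)
pose f k j :=
  qpoch (c / a) q k * qpoch (a * c / q) q k * qpoch v q k * qpoch (- v) q k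
  / (qpoch c q k * qpoch (- c) q k) * q ^+ k
  * ((-1) ^+ j * q ^+ 'C(j, 2) * (q ^+ n)^-1 ^+ j * qpoch (q ^+ m)^-1 q j
     / (qpoch q q j * qpoch q q (k - j) * qpoch (v / q ^+ n) q j
        * (qpoch (v ^+ 2 * q ^+ j / q) q j * qpoch (v ^+ 2 * q ^+ j.*2) q (k - j)))).
transitivity (\sum_(0 <= j < m.+1) \sum_(0 <= r < (m + n - j).+1) f (j + r)%N j).
  apply: eq_big_nat => j /andP[_ hj]; rewrite ltnS in hj.
  have hjM : (j <= m + n)%N by rewrite (leq_trans hj) ?leq_addr.
  have hvN : v * q ^+ j = (q ^+ (m + n - j))^-1.
    by rewrite /v -{1}(@subnK j (m + n)) ?exprD ?invfM ?divfK ?expf_neq0 //; lia.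
  have hvN2 : v ^+ 2 * q ^+ j.*2 = (q ^+ (m + n - j).*2)^-1.
    by rewrite -!muln2 !exprM -exprMn hvN exprVn.
  have hqN i : (0 < i <= (m + n - j).*2)%N -> q ^+ i != 1.
    by move=> hi; apply: hq; lia.
  have := @andrews_q_watson F q (a * c / q * q ^+ j) (c / a * q ^+ j) (m + n - j) q0.
  have -> : a * c / q * q ^+ j * q = a * c * q ^+ j by field.
  have -> : c / a * q ^+ j * q = q * q ^+ j * c / a by field.
  have -> : a * c / q * q ^+ j * (c / a * q ^+ j) * q = c ^+ 2 * q ^+ j.*2.
    by rewrite -addnn exprD; field; rewrite q0 a0.
  move=> <-; last by move=> i hi; apply: hqN; lia.
  rewrite [X in _ * X]mulr_suml mulr_sumr.
  apply: eq_big_nat => r /andP[_ hr]; rewrite ltnS in hr.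
  have hrM : (r <= m + n)%N by rewrite (leq_trans hr) ?leq_subr.
  rewrite /f addKn.
  have HB := qpoch_base_change q0 hqN hr.
  (* The first r factors in base q^2 split into (cq^j, -cq^j; q)_r, which complete (c, -c; q)_j to
     index j + r. *)
  have Ec : qpoch (c ^+ 2 * q ^+ j.*2) (q ^+ 2) (m + n - j)
     = qpoch (c * q ^+ j) q r * qpoch (- c * q ^+ j) q r
       * qpoch (c ^+ 2 * q ^+ j.*2 * (q ^+ 2) ^+ r) (q ^+ 2) (m + n - j - r).
    have <- : (c * q ^+ j) ^+ 2 = c ^+ 2 * q ^+ j.*2 by rewrite exprMn -exprM muln2.
    by rewrite -{1}(subnKC hr) qpochD mulNr -qpoch_sqr.
  rewrite Ec (qpochD (c / a)) (qpochD (a * c / q)) (qpochD v) (qpochD (- v)).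
  rewrite (qpochD c) (qpochD (- c)) (mulNr c) (mulNr v) hvN hvN2 binSS2 (exprD q j) (exprM q n j).
  rewrite (binSS2 r) (exprD q 'C(j, 2)) (exprD q 'C(r, 2)).
  (* The denominators in negative powers of q have factors 1 - q^(i-K) with 0 < K - i <= 2(m + n),
     the range covered by [hq]. *)
  have hd i K : (i < K <= (m + n).*2)%N -> (q ^+ K)^-1 * q ^+ i != 1.
    move=> hi; rewrite -(@subnK i K) ?exprD ?invfM ?divfK ?expf_neq0 //; last by lia.
    by rewrite invr_eq1 hq //; lia.
  have h1 : qpoch (q ^+ (m + n - j).*2)^-1 q r != 0.
    by apply/qpoch_neq0 => i hi; apply: hd; lia.
  have h2 : qpoch (q ^+ 2) (q ^+ 2) (m + n - j - r) != 0.
    by apply/qpoch_neq0 => i hi; rewrite -exprS -exprM; apply: hq; lia.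
  have h3 : qpoch q (q ^+ 2) (m + n - j) != 0.
    by apply/qpoch_neq0 => i hi; rewrite -exprM -exprS; apply: hq; lia.
  have h4 : qpoch (v / q ^+ n) q j != 0.
    apply/qpoch_neq0 => i hi; rewrite /v -invfM -exprD; apply: hd; lia.
  have h5 : qpoch (v ^+ 2 * q ^+ j / q) q j != 0.
    case: (j) hj => [|j'] hj'; first by rewrite qpoch0 oner_neq0.
    apply/qpoch_neq0 => i hi.
    rewrite (exprSr q j') mulrA mulfK // -mulrA -exprD /v exprVn -exprM; apply: hd; lia.
  have h6 : qpoch (c ^+ 2 * q ^+ j.*2) (q ^+ 2) (m + n - j) != 0.
    have -> : c ^+ 2 * q ^+ j.*2 = (c * q ^+ j) ^+ 2 by rewrite exprMn -exprM muln2.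
    rewrite qpoch_sqr mulf_neq0 //; apply/qpoch_neq0 => i hi.
      by rewrite -mulrA -exprD hc //; lia.
    by rewrite -mulNr -mulrA -exprD hmc //; lia.
  move: h6; rewrite Ec (mulNr c) !mulf_eq0 !negb_or => /andP[/andP[h6 h7] h8].
  have h9 : qpoch c q j != 0.
    by apply/qpoch_neq0 => i hi; apply: hc; apply: leq_trans hjM.
  have h10 : qpoch (- c) q j != 0.
    by apply/qpoch_neq0 => i hi; apply: hmc; apply: leq_trans hjM.
  have hqM i : (0 < i <= m + n)%N -> q ^+ i != 1 
    by case/andP=> i0 hi; rewrite hq // i0 -addnn (leq_trans hi) ?leq_addr.
  have h11 := qpoch_unit_root hqM hjM.
  have h12 := qpoch_unit_root hqM hrM.
  have h13 : q ^+ 'C(r, 2) != 0 by rewrite expf_neq0.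
  have -> : qpoch q q (m + n - j + (m + n - j - r))
    = qpoch (q ^+ (m + n - j))^-1 q r * qpoch (- (q ^+ (m + n - j))^-1) q r *
    (qpoch (q ^+ 2) (q ^+ 2) (m + n - j - r) * qpoch q (q ^+ 2) (m + n - j))
     / (q ^+ 'C(r, 2) * qpoch (q ^+ (m + n - j).*2)^-1 q r).
    by rewrite -HB; field; rewrite h1 h13.
  rewrite exprVn; field.
  by rewrite h1 h2 h3 h4 h5 h6 h7 h8 h9 h10 h11 h12 h13 !expf_neq0.
transitivity (\sum_(0 <= k < (m + n).+1) \sum_(0 <= j < k.+1) f k j).
  (* The terms with m < j <= m + n vanish through (q^(-m); q)_j, so the j-sum may be completed to a
     full triangle. *)
  rewrite sum_triangle [RHS](big_cat_nat (n := m.+1)) //=; last by lia.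
  rewrite [X in _ = _ + X]big1_seq ?addr0 // => j /andP[_].
  rewrite mem_index_iota => /andP[hj _].
  apply: big1 => r _; rewrite /f (_ : qpoch (q ^+ m)^-1 q j = 0); last first.
    by apply: qpoch_eq0 hj _; rewrite mulVf // expf_neq0.
  by rewrite !(mulr0, mul0r).
transitivity (\sum_(0 <= k < (m + n).+1)
     qpoch (c / a) q k * qpoch (a * c / q) q k * qpoch (q ^+ n)^-1 q k
      * qpoch (- v) q k
      / (qpoch q q k * qpoch c q k * qpoch (- c) q k
         * qpoch ((q ^+ n)^-1 * v) q k) * q ^+ k).
  apply: eq_big_nat => k /andP[_ hk]; rewrite ltnS in hk.
  rewrite /f -mulr_sumr.
  have := @very_well_poised_6phi5 F q (q ^+ m)^-1 v (q ^+ n)^-1 k q0.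
  have Ef : (q ^+ m)^-1 * (q ^+ n)^-1 = v by rewrite /v exprD invfM.
  have Ew : (q ^+ m)^-1 * v * (q ^+ n)^-1 = v ^+ 2 by rewrite mulrAC Ef expr2.
  rewrite Ef Ew; set S := \sum_(_ <= _ < _) _ => hS.
  have Pvn j : (j <= k)%N -> qpoch (v / q ^+ n) q j != 0.
    move=> hj; apply/qpoch_neq0 => i hi.
    rewrite /v -invfM -exprD -(@subnK i (m + n + n)) ?exprD ?invfM ?divfK ?expf_neq0 //; last by lia.
    by rewrite invr_eq1 hq //; lia.
  have {}hS := hS _ _.
  transitivity (qpoch (c / a) q k * qpoch (a * c / q) q k * qpoch (- v) q k
     / (qpoch c q k * qpoch (- c) q k) * q ^+ k * (S / qpoch (v / q ^+ n) q k)).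
    rewrite /S [X in _ = _ * X]mulr_suml !mulr_sumr.
    apply: eq_big_nat => j /andP[_ hj]; rewrite ltnS in hj.
    have Esplit x : qpoch x q k = qpoch x q j * qpoch (x * q ^+ j) q (k - j).
      by rewrite -qpochD subnKC.
    have E : qpoch (v / q ^+ n * q ^+ j) q (k - j) / qpoch (v / q ^+ n) q k
        = (qpoch (v / q ^+ n) q j)^-1.
      have := Pvn _ (leqnn k); rewrite Esplit.
      by rewrite mulf_eq0 negb_or => /andP[h1 h2]; field; rewrite h1 h2.
    rewrite !invfM -E (Esplit v); ring.
  rewrite hS; first by rewrite (mulrC _ v) !invfM; ring.
  - by move=> i hi; rewrite hq //; lia.
  - move=> i hi.
    rewrite /v exprVn -exprM -(@subnK i ((m + n) * 2)) ?exprD ?invfM ?divfK ?expf_neq0 //; last by lia.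
    by rewrite invr_eq1 hq //; lia.
(* Likewise (q^(-n); q)_k = 0 for k > n cuts the range from m + n down to n. *)
rewrite [LHS](big_cat_nat (n := n.+1)) //=; last by lia.
rewrite [X in _ + X]big1_seq ?addr0 // => k /andP[_].
rewrite mem_index_iota => /andP[hk _].
rewrite (_ : qpoch (q ^+ n)^-1 q k = 0) ?(mulr0, mul0r) //.
by apply: qpoch_eq0 hk _; rewrite mulVf // expf_neq0.
Qed.

End InnerSum.

(** * Removing l *)

Section Connection.
Variables (F : fieldType) (q : F).

(** The textbook form multiplied by (bf; q)_l, because [e] and [f] will carry the free parameter x =
    q^k. The remaining denominators involve only ef and bef, from which x cancels. *)
Lemma very_well_poised_6phi5_ratio (b e f : F) l : q != 0 ->
    (forall i, (0 < i <= l)%N -> q ^+ i != 1) ->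
    1 - b * e * f / q != 0 -> qpoch (b * e * f) q l.*2 != 0 ->
    qpoch (e * f) q l != 0 ->
  let A := b * e * f / q in
  \sum_(0 <= i < l.+1)
     (1 - A * q ^+ i.*2) / (1 - A)
     * (qpoch A q i * qpoch b q i * qpoch (q ^+ l)^-1 q i
        / (qpoch q q i * qpoch (e * f) q i * qpoch (A * q ^+ l.+1) q i))
     * (q ^+ l * f) ^+ i * (qpoch e q i * qpoch (b * f * q ^+ i) q (l - i))
  = qpoch (b * e * f) q l * qpoch f q l / qpoch (e * f) q l.
Proof.
move=> q0 hq hA hw hef A.
have Pq := qpoch_unit_root hq.
have hwi i : (i < l.*2)%N -> b * e * f * q ^+ i != 1.
  by move/qpoch_neq0: hw => hw hi; exact: hw.
have HS := very_well_poised_6phi5 q0 hq (fun i hi => hwi i (ltnW hi)).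
rewrite [RHS](_ : _ = qpoch f q l / qpoch q q l
  * (qpoch (b * e * f) q l * qpoch q q l / qpoch (e * f) q l)); last first.
  by field; rewrite hef Pq.
rewrite -HS mulr_suml; apply: eq_big_nat => i /andP[_ hi]; rewrite ltnS in hi.
have Eef : qpoch (e * f) q l = qpoch (e * f) q i * qpoch (e * f * q ^+ i) q (l - i).
  by rewrite -qpochD subnKC.
have Eq : qpoch (q ^+ l)^-1 q i = (qpoch q q l / qpoch q q (l - i))
    * ((-1) ^+ i * q ^+ 'C(i, 2) / q ^+ l ^+ i).
  have -> : (q ^+ l)^-1 = q^-1 * q / q ^+ (l - i + i) by rewrite subnK // mulVf // mul1r.
  rewrite qpoch_rev ?invr_eq0 // invrK /rev_factor.
  have -> : qpoch q q l = qpoch q q (l - i) * qpoch (q * q ^+ (l - i)) q i.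
    by rewrite -qpochD subnK.
  rewrite [qpoch q q (l - i) * _]mulrC mulfK ?Pq ?leq_subr //.
  congr (_ * _); rewrite -exprM -[in RHS](subnK hi) mulnDl exprD exprVn.
  have -> : (i * i = 'C(i, 2) + 'C(i, 2) + i)%N.
    by elim: (i) => // i' IH; rewrite mulnSr mulSn IH binSS2; lia.
  by rewrite !exprD; field; rewrite !expf_neq0.
(* Both sides are (A; q)_(l+1+i), cut at i, 2i, 2i + 1 on the left and at 1, l + 1 on the right. *)
have EA : qpoch A q i * (1 - A * q ^+ i.*2) * (qpoch (A * q ^+ i) q i
   * qpoch (b * e * f * q ^+ i.*2) q (l - i))
   = (1 - A) * (qpoch (b * e * f) q l * qpoch (A * q ^+ l.+1) q i).
  have -> : b * e * f = A * q by rewrite /A divfK.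
  have -> : (1 - A) * (qpoch (A * q) q l * qpoch (A * q ^+ l.+1) q i) = qpoch A q (l.+1 + i).
    by rewrite qpochD qpochSl mulrA.
  have -> : (l.+1 + i = i + (i + (1 + (l - i))))%N by lia.
  rewrite qpochD (qpochD (A * q ^+ i)) (qpochD _ _ 1 (l - i)) (qpochS _ _ 0) qpoch0 expr0.
  have -> : A * q ^+ i * q ^+ i = A * q ^+ i.*2 by rewrite -mulrA -exprD addnn.
  have -> : A * q * q ^+ i.*2 = A * q ^+ i.*2 * q ^+ 1 by rewrite expr1 mulrAC.
  by ring.
have hd1 : qpoch (A * q ^+ l.+1) q i != 0.
  apply/qpoch_neq0 => s hs; rewrite /A exprS mulrA divfK // -mulrA -exprD.
  by apply: hwi; lia.
have hd2 : qpoch (A * q ^+ i) q i != 0.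
  case: (i) hi => [|i'] hi'; first by rewrite qpoch0 oner_neq0.
  apply/qpoch_neq0 => s hs; rewrite /A exprS mulrA divfK // -mulrA -exprD.
  by apply: hwi; lia.
have hd3 : qpoch (b * e * f * q ^+ i.*2) q (l - i) != 0.
  apply/qpoch_neq0 => s hs; rewrite -mulrA -exprD.
  by apply: hwi; lia.
have hq1 := Pq _ hi; have hq2 := Pq _ (leq_subr i l).
move: hef; rewrite Eef mulf_eq0 negb_or => /andP[he1 he2].
have -> : b * e * f * q ^+ i / q = A * q ^+ i by rewrite mulrAC.
have {EA} EA' : (1 - A * q ^+ i.*2) / (1 - A) * (qpoch A q i / qpoch (A * q ^+ l.+1) q i)
  = qpoch (b * e * f) q l / (qpoch (A * q ^+ i) q i
   * qpoch (b * e * f * q ^+ i.*2) q (l - i)).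
  apply/eqP; rewrite mulf_div eqr_div ?mulf_neq0 //; apply/eqP.
  transitivity (qpoch A q i * (1 - A * q ^+ i.*2) * (qpoch (A * q ^+ i) q i
   * qpoch (b * e * f * q ^+ i.*2) q (l - i))); first by ring.
  by rewrite EA; ring.
transitivity ((1 - A * q ^+ i.*2) / (1 - A) * (qpoch A q i / qpoch (A * q ^+ l.+1) q i)
  * (qpoch b q i * qpoch (q ^+ l)^-1 q i / (qpoch q q i * qpoch (e * f) q i)
     * (q ^+ l * f) ^+ i * (qpoch e q i * qpoch (b * f * q ^+ i) q (l - i)))).
  by rewrite !invfM; ring.
rewrite EA' Eq exprMn.
by field; rewrite hd2 hd3 hq1 hq2 he1 he2 !expf_neq0.
Qed.

End Connection.

(** * Connection coefficients that remove l *)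

Section ConnectionCoefficients.
Variables (F : fieldType) (q : F).

(** Since (y; q)_s (yq^s; q)_t is symmetric under exchanging s and t, products of length k can be
    traded for products of length at most l in which k enters only through x = q^k. What remains is
    a 6phi5 sum of length l. *)
Lemma qpoch_connection (a c : F) l k : q != 0 -> a != 0 -> c != 0 ->
    (forall i, (0 < i <= l)%N -> q ^+ i != 1) ->
  let A := q / (q ^+ l.*2 * a ^+ 2) in
    1 - A != 0 ->
    qpoch (q ^+ l / q * a ^+ 2) q l != 0 ->
    qpoch (A * q ^+ l.+1) q l != 0 ->
    qpoch (q ^+ l / q * a * c) q l != 0 ->
    qpoch c q l != 0 -> qpoch c q k != 0 -> qpoch (q ^+ l * c) q k != 0 ->
  qpoch a q l * qpoch (q ^+ l / q * a * c) q l
    / (qpoch c q l * qpoch (q ^+ l / q * a ^+ 2) q l)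
  * \sum_(0 <= i < l.+1)
     q ^+ i / c ^+ i * ((1 - A * q ^+ i.*2) / (1 - A))
     * (qpoch (q ^+ l)^-1 q i * qpoch (c / a) q i * qpoch A q i
        / (qpoch q q i * qpoch (q ^+ 2 / (q ^+ l.*2 * a * c)) q i
           * qpoch (A * q ^+ l.+1) q i))
     * (qpoch (q ^+ (l - i) * a) q k * qpoch (q / (q ^+ (l - i) * a)) q k
        / qpoch (q ^+ l * c) q k)
  = qpoch a q k * qpoch (q / (q ^+ l * a)) q k / qpoch c q k.
Proof.
move=> q0 a0 c0 hq A hA ha2 hAl hac hcl hck hclk.
set x := q ^+ k; have x0 : x != 0 by rewrite expf_neq0.
have ql0 : q ^+ l != 0 by rewrite expf_neq0.
have rev0 (y : F) : y != 0 ->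
    qpoch (y * q / q ^+ l) q l = qpoch y^-1 q l * (y ^+ l * rev_factor q 0 l).
  by move=> y0; rewrite (qpoch_rev 0) // expr0 mulr1.
have El2 : q ^+ l.*2 = q ^+ l * q ^+ l by rewrite -exprD addnn.
have Ew : A * q = q / (q ^+ l * a ^+ 2) * q / q ^+ l.
  by rewrite /A El2; field; rewrite a0 ql0.
have Rw := rev0 (q / (q ^+ l * a ^+ 2)).
have Ree := rev0 (q / (q ^+ l * a * c)).
have Rf := rev0 (c * x)^-1.
have V1 : (q / (q ^+ l * a ^+ 2))^-1 = q ^+ l / q * a ^+ 2.
  by field; rewrite q0 a0 ql0.
have V2 : (q / (q ^+ l * a * c))^-1 = q ^+ l / q * a * c.
  by field; rewrite q0 a0 c0 ql0.
rewrite V1 in Rw; rewrite V2 in Ree; rewrite invrK in Rf.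
have y1 := mulf_neq0 q0 (invr_neq0 (mulf_neq0 ql0 (expf_neq0 2 a0))).
have {}Rw := Rw y1.
rewrite -Ew in Rw.
have y2 := mulf_neq0 q0 (invr_neq0 (mulf_neq0 (mulf_neq0 ql0 a0) c0)).
have {}Ree := Ree y2.
have {}Rf := Rf (invr_neq0 (mulf_neq0 c0 x0)).
(* [e] is proportional to x and [f] to 1/x, so ef and bef = Aq are free of x; this makes the
   coefficients independent of k. *)
pose b := c / a; pose e := q * x / (q ^+ l * a); pose f := q / (q ^+ l * (c * x)).
have Ebef : b * e * f = A * q.
  by rewrite /b /e /f /A El2; field; rewrite a0 c0 x0 ql0.
have Eef : e * f = q ^+ 2 / (q ^+ l.*2 * a * c).
  by rewrite /e /f El2; field; rewrite a0 c0 x0 ql0.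
have Ebf : b * f = (a * x)^-1 * q / q ^+ l.
  by rewrite /b /f; field; rewrite a0 c0 x0 ql0.
have Ef : f = (c * x)^-1 * q / q ^+ l.
  by rewrite /f; field; rewrite c0 x0 ql0.
have Ee2 : e * f = q / (q ^+ l * a * c) * q / q ^+ l.
  by rewrite Eef El2; field; rewrite a0 c0 ql0.
have HS := @very_well_poised_6phi5_ratio F q b e f l q0 hq.
rewrite Ebef mulfK // -/A in HS.
have rl0 := rev_factor_neq0 0 l q0.
have hw1 : qpoch (A * q) q l != 0.
  by rewrite Rw (mulf_neq0 ha2) // (mulf_neq0 (expf_neq0 l y1)).
have hw2 : qpoch (A * q) q l.*2 != 0.
  by rewrite -addnn qpochD -mulrA -exprS mulf_neq0.
have hef : qpoch (e * f) q l != 0.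
  by rewrite Ee2 Ree (mulf_neq0 hac) // (mulf_neq0 (expf_neq0 l y2)).
have {HS} := HS hA hw2 hef; rewrite /= => HS.
(* [G] is the part common to all terms once lengths have been exchanged; it already contains the
   target (a, q^(1-l)/a; q)_k. *)
pose G := qpoch (q ^+ l / q * a * c) q l
  / (qpoch c q l * qpoch (q ^+ l / q * a ^+ 2) q l)
  * (qpoch a q k * qpoch (q / (q ^+ l * a)) q k
     * ((-1) ^+ l * a ^+ l * q ^+ 'C(l, 2) * x ^+ l)) / qpoch (q ^+ l * c) q k.
have Eckl : qpoch c q l * qpoch (q ^+ l * c) q k = qpoch c q k * qpoch (c * x) q l.
  by rewrite [q ^+ l * c]mulrC -!qpochD addnC.
transitivity (G * (qpoch (A * q) q l * qpoch f q l / qpoch (e * f) q l)); last first.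
  have hcx : qpoch (c * x) q l != 0.
    have := mulf_neq0 hcl hclk; rewrite Eckl mulf_eq0 negb_or => /andP[] //.
  rewrite /G Rw Ee2 Ree Ef Rf.
  have -> : qpoch (c * x) q l = qpoch c q l * qpoch (q ^+ l * c) q k / qpoch c q k.
    by rewrite Eckl [RHS]mulrC mulKf.
  have Er : rev_factor q 0 l = ((-1) ^+ l * q ^+ 'C(l, 2))^-1.
    by rewrite /rev_factor mul0n expr0 mul1r invfM invr_sign.
  have Ep : (q / (q ^+ l * a * c)) ^+ l
     = (q / (q ^+ l * a ^+ 2)) ^+ l * (c * x)^-1 ^+ l * (a ^+ l * x ^+ l).
    by rewrite -!exprMn; congr (_ ^+ _); field; rewrite a0 c0 x0 ql0.
  rewrite Er Ep exprVn.
  move: (expf_neq0 l y1) (expf_neq0 'C(l, 2) q0) (expf_neq0 l (mulf_neq0 c0 x0)).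
  move: (expf_neq0 l a0) (expf_neq0 l x0).
  have hs0 : (-1) ^+ l != 0 :> F by rewrite signr_eq0.
  move=> h1 h2 h3 h4 h5.
  by field; rewrite hck ha2 hac hcl hclk hs0 h1 h2 h3 h4 h5.
rewrite -HS !mulr_sumr; apply: eq_big_nat => i /andP[_ hi]; rewrite ltnS in hi.
rewrite -Eef /G.
(* With h = l - i, [S1] and [S2] exchange lengths, [R1] and [R2] reverse (aq^h; q)_i and (ax; q)_h,
   and [T] compares the remaining powers and signs. *)
have K : qpoch a q l * (qpoch (q ^+ (l - i) * a) q k * qpoch (q / (q ^+ (l - i) * a)) q k)
    * (q ^+ i / c ^+ i)
  = (q ^+ l * f) ^+ i * (qpoch e q i * qpoch (b * f * q ^+ i) q (l - i))
    * (qpoch a q k * qpoch (q / (q ^+ l * a)) q k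
       * ((-1) ^+ l * a ^+ l * q ^+ 'C(l, 2) * x ^+ l)).
  set h := (l - i)%N; have hl : l = (h + i)%N by rewrite subnK.
  have R1 := @qpoch_rev F q a^-1 h i q0 (invr_neq0 a0).
  have R2 := @qpoch_rev F q (a * x)^-1 0 h q0 (invr_neq0 (mulf_neq0 a0 x0)).
  rewrite !invrK expr0 mulr1 add0n in R1 R2.
  have S1 : qpoch a q l * qpoch (q ^+ h * a) q k
     = qpoch (a * q ^+ h) q i * (qpoch a q k * qpoch (a * x) q h).
    have -> : qpoch a q l = qpoch a q h * qpoch (a * q ^+ h) q i.
      by rewrite -qpochD -hl.
    have E2 : qpoch a q h * qpoch (a * q ^+ h) q k = qpoch a q k * qpoch (a * x) q h.
      by rewrite -!qpochD addnC.
    by rewrite -E2 [q ^+ h * a]mulrC; ring.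
  have S2 : qpoch (q / (q ^+ l * a)) q k * qpoch e q i
     = qpoch (q / (q ^+ l * a)) q i * qpoch (q / (q ^+ h * a)) q k.
    have -> : e = q / (q ^+ l * a) * x by rewrite /e mulrAC.
    rewrite -qpochD addnC qpochD; congr (_ * qpoch _ _ _).
    by rewrite hl exprD; field; rewrite a0 !expf_neq0.
  have -> : b * f * q ^+ i = (a * x)^-1 * q / q ^+ h.
    by rewrite Ebf hl exprD; field; rewrite a0 x0 !expf_neq0.
  have T : q ^+ i / c ^+ i = (q ^+ l * f) ^+ i * (a^-1 ^+ i * rev_factor q h i)
     * ((a * x)^-1 ^+ h * rev_factor q 0 h)
     * ((-1) ^+ l * a ^+ l * q ^+ 'C(l, 2) * x ^+ l).
    have -> : q ^+ l * f = q / (c * x) by rewrite /f; field; rewrite c0 x0 ql0.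
    rewrite /rev_factor hl bin2D mul0n expr0 mul1r !(exprMn, exprVn, exprD).
    have hs (j : nat) : (-1) ^+ j * (-1) ^+ j = 1 :> F by rewrite -expr2 sqrr_sign.
    transitivity (q ^+ i / c ^+ i * ((-1) ^+ i * (-1) ^+ i) * ((-1) ^+ h * (-1) ^+ h)).
      by rewrite !hs !mulr1.
    by field; rewrite !expf_neq0.
  transitivity ((qpoch a q l * qpoch (q ^+ h * a) q k)
    * qpoch (q / (q ^+ h * a)) q k * (q ^+ i / c ^+ i)); first by ring.
  rewrite R2 S1 T.
  transitivity (qpoch (q / (q ^+ l * a)) q k * qpoch e q i
    * (q ^+ l * f) ^+ i * (qpoch (a * x) q h * ((a * x)^-1 ^+ h * rev_factor q 0 h))
    * (qpoch a q k * ((-1) ^+ l * a ^+ l * q ^+ 'C(l, 2) * x ^+ l))); last by ring.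
  rewrite S2; have -> : q / (q ^+ l * a) = a^-1 * q / q ^+ (h + i).
    by rewrite -hl; field; rewrite a0 ql0.
  by rewrite R1; ring.
transitivity (qpoch (q ^+ l / q * a * c) q l
  / (qpoch c q l * qpoch (q ^+ l / q * a ^+ 2) q l) / qpoch (q ^+ l * c) q k
  * ((1 - A * q ^+ i.*2) / (1 - A))
  * (qpoch (q ^+ l)^-1 q i * qpoch b q i * qpoch A q i
        / (qpoch q q i * qpoch (e * f) q i
           * qpoch (A * q ^+ l.+1) q i))
  * (qpoch a q l * (qpoch (q ^+ (l - i) * a) q k * qpoch (q / (q ^+ (l - i) * a)) q k)
    * (q ^+ i / c ^+ i))); first by rewrite /b; ring.
by rewrite K; ring.
Qed.

End ConnectionCoefficients.

(** * The double sum *)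

Section Main.
Variable (F : fieldType).

Lemma expfzB (q : F) (z : int) (s t : nat) : q != 0 -> z = s%:Z - t%:Z ->
  q ^ z = q ^+ s / q ^+ t.
Proof. by move=> q0 ->; rewrite expfzDr // -exprnP exprnN. Qed.

Lemma qpochs2 (x0 x1 y : F) n :
  qpochs [:: x0; x1] y n = qpoch x0 y n * qpoch x1 y n.
Proof. by rewrite /qpochs !big_cons big_nil mulr1. Qed.

Lemma qpochs3 (x0 x1 x2 y : F) n :
  qpochs [:: x0; x1; x2] y n = qpoch x0 y n * qpoch x1 y n * qpoch x2 y n.
Proof. by rewrite /qpochs big_cons -/(qpochs _ _ _) qpochs2 mulrA. Qed.

Lemma qpochs4 (x0 x1 x2 x3 y : F) n : qpochs [:: x0; x1; x2; x3] y n
  = qpoch x0 y n * qpoch x1 y n * qpoch x2 y n * qpoch x3 y n.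
Proof. by rewrite /qpochs big_cons -/(qpochs _ _ _) qpochs3 !mulrA. Qed.

Lemma qpochs5 (x0 x1 x2 x3 x4 y : F) n : qpochs [:: x0; x1; x2; x3; x4] y n
  = qpoch x0 y n * qpoch x1 y n * qpoch x2 y n * qpoch x3 y n * qpoch x4 y n.
Proof. by rewrite /qpochs big_cons -/(qpochs _ _ _) qpochs4 !mulrA. Qed.

(** Each range of i is read off one kind of denominator. For i <= 2n, odd i come from (q; q^2)_(m+n)
    and even i from q^(i/2) being neither 1 nor -1. For 2n < i <= m + 2n one uses (q^(-m-2n); q)_m,
    and beyond that the first factor of (q^(j-2m-2n-1); q)_j at j = 2(m+n) + 1 - i. *)
Lemma q_powers_neq1 (q : F) m n : q != 0 ->
    (forall i, (0 < i <= n)%N -> q ^+ i != -1) ->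
    qpoch q q n != 0 -> qpoch q (q ^+ 2) (m + n) != 0 ->
    qpoch ((q ^+ (m + n))^-1 / q ^+ n) q m != 0 ->
    (forall j, (j <= m)%N -> qpoch ((q ^+ (m + n))^-1 ^+ 2 * q ^+ j / q) q j != 0) ->
  forall i, (0 < i <= (m + n).*2)%N -> q ^+ i != 1.
Proof.
move=> q0 hmq hqn hq2 hv hvv i /andP[i0 hi].
have [hin|hin] := leqP i n.*2.
  have [/esym Eodd|Eeven] := boolP (odd i).
    have Ei : i = (2 * i./2).+1 by rewrite mul2n -[LHS]odd_double_half -Eodd.
    rewrite Ei exprS exprM; move/qpoch_neq0: hq2; apply.
    by rewrite Ei mul2n ltn_double in hin; rewrite (leq_trans hin) ?leq_addl.
  have Ei : i = (i./2 + i./2)%N.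
    by rewrite addnn -[LHS]odd_double_half (negbTE Eeven).
  have hh : (0 < i./2 <= n)%N.
    by move: i0 hin; rewrite Ei -[n.*2]addnn; clear; lia.
  rewrite Ei exprD -expr2 sqrf_eq1 negb_or (hmq _ hh) andbT.
  case: (i./2) hh => [|s] // hs.
  by rewrite exprS; move/qpoch_neq0: hqn; apply.
have inv_neq1 K s : (K = s + i)%N -> (q ^+ K)^-1 * q ^+ s != 1 -> q ^+ i != 1.
  by move=> ->; rewrite exprD invfM mulrAC mulVf ?expf_neq0 // mul1r invr_eq1.
have [him|him] := leqP i (m + n + n).
  have hs : (m + n + n - i < m)%N by clear - hin him; lia.
  move/qpoch_neq0: hv => /(_ _ hs).
  by rewrite -invfM -exprD; apply: inv_neq1; rewrite subnK.
have hj : ((m + n).*2.+1 - i <= m)%N by clear - him; lia.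
have hs : (0 < (m + n).*2.+1 - i)%N by rewrite subn_gt0.
have /qpoch_neq0/(_ _ hs) := hvv _ hj; rewrite expr0 mulr1.
have -> : (q ^+ (m + n))^-1 ^+ 2 * q ^+ ((m + n).*2.+1 - i) / q
   = (q ^+ (m + n).*2.+1)^-1 * q ^+ ((m + n).*2.+1 - i).
  by rewrite exprVn -exprM exprS muln2 invfM mulrC mulrA.
by apply: inv_neq1; rewrite subnK // ltnW.
Qed.

(** The argument is purely algebraic, so it is carried out over an arbitrary field. *)
Theorem phi43_double_sum (q a c : F) (l m n : nat)
  (hq : q != 0) (ha : a != 0) (hc : c != 0)
  (hphi : forall k : nat, (k <= n)%N ->
     qpochs [:: q; c; q ^ (1 - l%:Z - m%:Z - 2 * n%:Z) / c; - q] q k != 0)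
  (hpre1 : qpochs [:: c; q ^ (l%:Z - 1) * a ^+ 2] q l != 0)
  (hpre2 : qpochs [:: q ^+ (l + m + n) * c; - q] q n != 0)
  (hT0 : 1 - q ^ (1 - 2 * l%:Z) / a ^+ 2 != 0)
  (hTi : forall i : nat, (i <= l)%N ->
     qpochs [:: q; q ^ (2 - 2 * l%:Z) / (a * c); q ^ (2 - l%:Z) / a ^+ 2] q i
       != 0)
  (hTj1 : forall j : nat, (j <= m)%N ->
     qpochs [:: q; q ^+ l * c; - q ^+ l * c; q ^ (- m%:Z - 2 * n%:Z);
                q ^ (j%:Z - 2 * m%:Z - 2 * n%:Z - 1)] q j != 0)
  (hTj2 : forall j : nat, (j <= m)%N ->
     qpochs [:: q; q ^+ (2 * l + 2 * j) * c ^+ 2] (q ^+ 2) (m + n - j) != 0) :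
  phi43 n a (q ^ (1 - l%:Z) / a) (q ^ (- n%:Z)) (- q ^ (- m%:Z - n%:Z))
        c (q ^ (1 - l%:Z - m%:Z - 2 * n%:Z) / c) (- q) q q
  = (qpochs [:: a; q ^ (l%:Z - 1) * a * c] q l
       / qpochs [:: c; q ^ (l%:Z - 1) * a ^+ 2] q l)
    * (qpochs [:: q ^+ (1 + m + n); - q ^+ l * c] q n
       / qpochs [:: q ^+ (l + m + n) * c; - q] q n)
    * \sum_(0 <= i < l.+1) \sum_(0 <= j < m.+1) Tterm q a c l m n i j.
Proof.
have ql0 s : q ^+ s != 0 by rewrite expf_neq0.
pose A := q / (q ^+ l.*2 * a ^+ 2).
(* Removing l replaces c by [c']. With [u] = q^(m+n) the lower parameter q^(1-l-m-2n)/c is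
   q^(1-n)/(c'u), as in [sears_q_over_a]. *)
pose c' := q ^+ l * c.
pose u := q ^+ (m + n).
have c'0 : c' != 0 by rewrite mulf_neq0.
have u0 : u != 0 by rewrite expf_neq0.
have Z1 : q ^ (l%:Z - 1) = q ^+ l / q by rewrite (@expfzB _ _ l 1).
have Z2 : q ^ (1 - 2 * l%:Z) / a ^+ 2 = A.
  by rewrite /A (@expfzB _ _ 1 l.*2 hq); [field; rewrite ha ql0 | clear; lia].
have Z3 : q ^ (2 - l%:Z) / a ^+ 2 = A * q ^+ l.+1.
  rewrite (@expfzB _ _ 2 l hq) // /A -addnn (exprD q l l) (exprS q l).
  by field; rewrite ha !ql0.
have Z4 : q ^ (2 - 2 * l%:Z) / (a * c) = q ^+ 2 / (q ^+ l.*2 * a * c).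
  by rewrite (@expfzB _ _ 2 l.*2 hq); [field; rewrite ha hc ql0 | clear; lia].
have Z5 : q ^ (1 - l%:Z - m%:Z - 2 * n%:Z) / c = q / q ^+ n / (c' * u).
  rewrite (@expfzB _ _ 1 (n + (l + (m + n))) hq); last by clear; lia.
  by rewrite /c' /u (exprD q n) (exprD q l); field; rewrite hc !ql0.
have Z6 : q ^ (- m%:Z - 2 * n%:Z) = u^-1 / q ^+ n.
  rewrite (@expfzB _ _ 0 (m + n + n) hq); last by clear; lia.
  by rewrite /u (exprD q (m + n)) invfM mul1r.
have Z7 j : q ^ (j%:Z - 2 * m%:Z - 2 * n%:Z - 1) = u^-1 ^+ 2 * q ^+ j / q.
  rewrite (@expfzB _ _ j (m + n + (m + n)).+1 hq); last by clear; lia.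
  by rewrite /u exprS (exprD q (m + n)) expr2; field; rewrite hq !ql0.
have Z8 : q ^ (1 - l%:Z) / a = q / (q ^+ l * a).
  by rewrite (@expfzB _ _ 1 l) // invfM mulrA.
have Z9 : q ^ (- m%:Z - n%:Z) = u^-1.
  by rewrite (@expfzB _ _ 0 (m + n) hq); [rewrite mul1r | clear; lia].
have Z10 s : q ^ (- s%:Z) = (q ^+ s)^-1.
  by rewrite (@expfzB _ _ 0 s) ?mul1r ?add0r.
rewrite Z5 in hphi; rewrite Z1 in hpre1; rewrite Z2 in hT0.
rewrite qpochs2 mulf_eq0 negb_or in hpre1.
rewrite qpochs2 mulf_eq0 negb_or in hpre2.
have {hphi}hphi k : (k <= n)%N -> [/\ qpoch q q k != 0 & qpoch c q k != 0].
  by move=> /hphi; rewrite qpochs4 !mulf_eq0 !negb_or => /andP[/andP[/andP[]]].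
have {hTi}hTi i : (i <= l)%N -> [/\ qpoch q q i != 0,
    qpoch (q ^+ 2 / (q ^+ l.*2 * a * c)) q i != 0 & qpoch (A * q ^+ l.+1) q i != 0].
  move=> /hTi; rewrite Z3 Z4 qpochs3 !mulf_eq0 !negb_or => /andP[/andP[]].
  by split.
have {hTj1}hTj1 j : (j <= m)%N -> [/\ qpoch (u^-1 / q ^+ n) q j != 0
    & qpoch (u^-1 ^+ 2 * q ^+ j / q) q j != 0].
  move=> /hTj1; rewrite Z6 Z7 qpochs5 !mulf_eq0 !negb_or => /andP[/andP[_]].
  by split.
have {hTj2} := hTj2 0 (leq0n m).
rewrite muln0 addn0 subn0 qpochs2 mulf_eq0 negb_or => /andP[hq2 hc2].
(* At j = 0 the base-q^2 denominator is (c'^2; q^2)_(m+n) = (c', -c'; q)_(m+n), so both factors are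
   nonzero to full length. *)
have Ec2 : q ^+ (2 * l) * c ^+ 2 = c' ^+ 2 by rewrite exprMn -exprM mulnC.
rewrite Ec2 qpoch_sqr mulf_eq0 negb_or in hc2.
case/andP: hc2 => hc'p hc'm; case/andP: hpre1 => hcl ha2; case/andP: hpre2 => hcu hmq.
have hmq1 i : (0 < i <= n)%N -> q ^+ i != -1.
  case: i => // i hi; move/qpoch_neq0: hmq => /(_ i hi).
  by rewrite mulNr -exprS eqr_oppLR.
have hq1 : forall i, (0 < i <= (m + n).*2)%N -> q ^+ i != 1.
  apply: q_powers_neq1 => //; first by case: (hphi _ (leqnn n)).
    by case: (hTj1 _ (leqnn m)).
  by move=> j /hTj1[].
have hql i : (0 < i <= l)%N -> q ^+ i != 1.
  case: i => // i hi; have [h _ _] := hTi _ (leqnn l).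
  by rewrite exprS; move/qpoch_neq0: h; apply.
have [_ hef hAl] := hTi _ (leqnn l).
(* Up to a nonzero scalar, (q^(l-1)ac; q)_l is the reversal of (q^(2-2l)/(ac); q)_l, a denominator
   of T. *)
have Eef : qpoch (q ^+ l / q * a * c) q l != 0.
  have y0 : q / (q ^+ l * a * c) != 0 by rewrite mulf_neq0 ?invr_eq0 ?mulf_neq0.
  have := @qpoch_rev F q (q / (q ^+ l * a * c)) 0 l hq y0.
  rewrite expr0 mulr1 add0n.
  have -> : q / (q ^+ l * a * c) * q / q ^+ l = q ^+ 2 / (q ^+ l.*2 * a * c).
    by rewrite -addnn (exprD q l l); field; rewrite ha hc ql0.
  have -> : (q / (q ^+ l * a * c))^-1 = q ^+ l / q * a * c.
    by field; rewrite hq ha hc ql0.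
  by move=> E; move: hef; rewrite E mulf_eq0 negb_or => /andP[].
have c'n s i : (i < n)%N -> qpoch s q (m + n) != 0 -> s * q ^+ i != 1.
  by move=> hi /qpoch_neq0; apply; rewrite (leq_trans hi) ?leq_addl.
pose C i := q ^+ i / c ^+ i * ((1 - A * q ^+ i.*2) / (1 - A))
     * (qpoch (q ^+ l)^-1 q i * qpoch (c / a) q i * qpoch A q i
        / (qpoch q q i * qpoch (q ^+ 2 / (q ^+ l.*2 * a * c)) q i
           * qpoch (A * q ^+ l.+1) q i)).
pose P := qpoch a q l * qpoch (q ^+ l / q * a * c) q l
    / (qpoch c q l * qpoch (q ^+ l / q * a ^+ 2) q l).
(* [S i] is the 4phi3 for l = 0 with a replaced by q^(l-i)a and c by [c']; [C i] is its connection
   coefficient. *)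
pose S i := \sum_(0 <= k < n.+1)
     qpoch (q ^+ (l - i) * a) q k * qpoch (q / (q ^+ (l - i) * a)) q k
      * qpoch (q ^+ n)^-1 q k * qpoch (- u^-1) q k
      / (qpoch q q k * qpoch c' q k * qpoch (q / q ^+ n / (c' * u)) q k
         * qpoch (- q) q k) * q ^+ k.
transitivity (P * \sum_(0 <= i < l.+1) C i * S i).
  rewrite /phi43 Z5 Z8 Z9 Z10.
  under [X in P * X]eq_bigr do rewrite mulr_sumr.
  rewrite exchange_big_nat /= mulr_sumr; apply: eq_big_nat => k /andP[_ hk].
  rewrite ltnS in hk; have [_ hck] := hphi _ hk.
  have hck' : qpoch c' q k != 0.
    by apply/qpoch_neq0 => i hi; apply: c'n hc'p; apply: leq_trans hk.
  have := @qpoch_connection F q a c l k hq ha hc hql hT0 ha2 hAl Eef hcl hck hck'.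
  rewrite -/A -/P !qpochs4 => HC.
  transitivity (qpoch a q k * qpoch (q / (q ^+ l * a)) q k / qpoch c q k
    * (qpoch (q ^+ n)^-1 q k * qpoch (- u^-1) q k
      / (qpoch q q k * qpoch (q / q ^+ n / (c' * u)) q k
         * qpoch (- q) q k) * q ^+ k)); first by rewrite !invfM; ring.
  rewrite -HC -mulrA mulr_suml; congr (_ * _); apply: eq_bigr => i _.
  by rewrite -/(C i) !invfM; ring.
rewrite !qpochs2 Z1 -/P -mulrA; congr (_ * _).
rewrite mulr_sumr; apply: eq_big_nat => i /andP[_ hi]; rewrite ltnS in hi.
have a'0 : q ^+ (l - i) * a != 0 by rewrite mulf_neq0.
have hcu' j : (j < n)%N -> c' * u * q ^+ j != 1.
  have <- : q ^+ (l + m + n) * c = c' * u.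
    by rewrite /c' /u -addnA (exprD q l) mulrAC.
  by move=> hj; move/qpoch_neq0: hcu; apply.
have huq j : (j < n)%N -> u * q * q ^+ j != 1.
  move=> hj; rewrite /u -exprSr -exprD hq1 //; clear - hj; lia.
have hq1n j : (0 < j <= n)%N -> q ^+ j != 1 by move=> hj; rewrite hq1 //; clear - hj; lia.
(* The Sears prefactor does not depend on i and is the second quotient of the claim.
   [double_sum_inner] is then read from right to left; with a' = q^(l-i)a one has a'c'/q =
   q^(2l-i-1)ac and c'/a' = q^i c/a, the parameters in T. *)
rewrite /S (sears_q_over_a hq a'0 c'0 u0 hq1n hmq1 _ _ hcu' huq);
  [ | by move=> j hj; apply: c'n | by move=> j hj; apply: c'n].
have := @double_sum_inner F q (q ^+ (l - i) * a) c' m n hq a'0 hq1.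
rewrite /= -/u => HD.
rewrite -HD; [ | by move=> j hj; move/qpoch_neq0: hc'p; apply
  | by move=> j hj; move/qpoch_neq0: hc'm; apply].
rewrite mulrCA mulr_sumr.
have -> : qpoch (u * q) q n = qpoch (q ^+ (1 + m + n)) q n.
  by rewrite /u -exprSr.
have -> : qpoch (c' * u) q n = qpoch (q ^+ (l + m + n) * c) q n.
  by rewrite /c' /u -addnA (exprD q l) mulrAC.
rewrite /c' mulNr; congr (_ * _); apply: eq_big_nat => j /andP[_ hj].
rewrite ltnS in hj.
have hl : l = (l - i + i)%N by rewrite subnK.
have El : q ^+ l = q ^+ (l - i) * q ^+ i by rewrite -exprD -hl.
have Y1 : q ^ (i%:Z - n%:Z * j%:Z + 'C(j.+1, 2)%:Z)
    = q ^+ i * (q ^+ 'C(j.+1, 2) / q ^+ (n * j)).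
  by rewrite (@expfzB _ _ (i + 'C(j.+1, 2)) (n * j) hq) ?exprD ?mulrA //; clear; lia.
have Y2 : q ^ (1 - 2 * l%:Z + 2 * i%:Z) / a ^+ 2 = A * q ^+ i.*2.
  rewrite (@expfzB _ _ i.*2.+1 l.*2 hq); last by clear; lia.
  by rewrite /A (exprS q i.*2); field; rewrite ha ql0.
have Y3 : q ^ (2 * l%:Z - i%:Z - 1) * a * c = q ^+ (l - i) * a * (q ^+ l * c) / q.
  rewrite (@expfzB _ _ (l + (l - i)) 1 hq); last by clear - hi; lia.
  by rewrite (exprD q l (l - i)) expr1; field.
have Y4 : q ^+ i * c / a = q ^+ l * c / (q ^+ (l - i) * a).
  by rewrite El; field; rewrite ha ql0.
have Y5 : q ^ (2 * l%:Z - i%:Z + j%:Z) * a * c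
    = q ^+ (l - i) * a * (q ^+ l * c) * q ^+ j.
  rewrite (@expfzB _ _ (l + (l - i) + j) 0 hq); last by clear - hi; lia.
  rewrite (exprD q (l + (l - i)) j) (exprD q l (l - i)) expr0 divr1; ring.
have Y6 : q ^+ (1 + i + j) * c / a = q * q ^+ j * (q ^+ l * c) / (q ^+ (l - i) * a).
  by rewrite El -addnA exprS exprD; field; rewrite ha ql0.
have Y7 : q ^+ (2 * l + 2 * j) * c ^+ 2 = (q ^+ l * c) ^+ 2 * q ^+ j.*2.
  by rewrite exprD mulrAC Ec2 mul2n.
rewrite /Tterm Y1 Y2 Y3 Y4 Y5 Y6 Y7 Z2 Z3 Z4 Z6 Z7 Z9 !Z10 !qpochs2 !qpochs3 !qpochs5 !mulNr.
rewrite /C.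
ring.
Qed.

End Main.

End DoubleSum.

Theorem mainTheorem16 (R : realType) (q a c : R[i]) (l m n : nat)
  (hq : q != 0) (ha : a != 0) (hc : c != 0)
  (* nonvanishing of the denominators of the 4phi3 series *)
  (hphi : forall k : nat, (k <= n)%N ->
     qpochs [:: q; c; q ^ (1 - l%:Z - m%:Z - 2 * n%:Z) / c; - q] q k != 0)
  (* nonvanishing of the denominators of the prefactor *)
  (hpre1 : qpochs [:: c; q ^ (l%:Z - 1) * a ^+ 2] q l != 0)
  (hpre2 : qpochs [:: q ^+ (l + m + n) * c; - q] q n != 0)
  (* nonvanishing of the denominators of T_{i,j}, 0 <= i <= l, 0 <= j <= m *)
  (hT0 : 1 - q ^ (1 - 2 * l%:Z) / a ^+ 2 != 0)
  (hTi : forall i : nat, (i <= l)%N ->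
     qpochs [:: q; q ^ (2 - 2 * l%:Z) / (a * c); q ^ (2 - l%:Z) / a ^+ 2] q i
       != 0)
  (hTj1 : forall j : nat, (j <= m)%N ->
     qpochs [:: q; q ^+ l * c; - q ^+ l * c; q ^ (- m%:Z - 2 * n%:Z);
                q ^ (j%:Z - 2 * m%:Z - 2 * n%:Z - 1)] q j != 0)
  (hTj2 : forall j : nat, (j <= m)%N ->
     qpochs [:: q; q ^+ (2 * l + 2 * j) * c ^+ 2] (q ^+ 2) (m + n - j) != 0) :
  phi43 n a (q ^ (1 - l%:Z) / a) (q ^ (- n%:Z)) (- q ^ (- m%:Z - n%:Z))
        c (q ^ (1 - l%:Z - m%:Z - 2 * n%:Z) / c) (- q) q q
  = (qpochs [:: a; q ^ (l%:Z - 1) * a * c] q l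
       / qpochs [:: c; q ^ (l%:Z - 1) * a ^+ 2] q l)
    * (qpochs [:: q ^+ (1 + m + n); - q ^+ l * c] q n
       / qpochs [:: q ^+ (l + m + n) * c; - q] q n)
    * \sum_(0 <= i < l.+1) \sum_(0 <= j < m.+1) Tterm q a c l m n i j.
Proof. exact: phi43_double_sum. Qed.
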